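(* Let $A\in\mathbb{C}^{m\times n}$, $B\in\mathbb{C}^{n\times \ell}$ and $D=AB$, and let $M,N,L$ be weights of order $m,n,\ell$ respectively. If $A^{[\dagger]}$ and $B^{[\dagger]}$ exist, then the following are equivalent: (i) $\operatorname{rank}\begin{pmatrix} D & AA^{[*]}D\\ DB^{[*]}B & DD^{[*]}D\end{pmatrix}=\operatorname{rank}(D)$. (ii) $(AB)^{[\dagger]}$ exists and $(AB)^{[\dagger]}=B^{[\dagger]}A^{[\dagger]}$.
   Context: All matrices are complex and $X^*$ denotes the complex conjugate transpose. A weight of order $n$ is an invertible Hermitian $n\times n$ matrix (not necessarily positive definite). The spaces $\mathbb{C}^m,\mathbb{C}^n,\mathbb{C}^\ell$ carry fixed weights $M,N,L$. The adjoint of a matrix $X\in\mathbb{C}^{p\times q}$ between spaces with weights $W_p$ (on $\mathbb{C}^p$) and $W_q$ (on $\mathbb{C}^q$) is $X^{[*]}=W_q^{-1}X^*W_p$; thus $A^{[*]}=N^{-1}A^*M$, $B^{[*]}=L^{-1}B^*N$, $D^{[*]}=L^{-1}D^*M$. The Moore-Penrose inverse $X^{[\dagger]}$ of $X\in\mathbb{C}^{p\times q}$ is the unique $Y\in\mathbb{C}^{q\times p}$, if it exists, satisfying $XYX=X$, $YXY=Y$, $(XY)^{[*]}=XY$ and $(YX)^{[*]}=YX$, where square matrices $Z$ acting on a space with weight $W$ have $Z^{[*]}=W^{-1}Z^*W$. It need not exist. *)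

(* Defs.v *)
From HB Require Import structures.
From mathcomp Require Import all_boot all_order all_algebra.
From mathcomp Require Export complex.
From mathcomp Require Export reals.

Set Implicit Arguments.
Unset Strict Implicit.
Unset Printing Implicit Defensive.

Import GRing.Theory Num.Theory.
Local Open Scope ring_scope.
Local Open Scope sesquilinear_scope.

Section WeightedMoorePenrose.
Variable C : numClosedFieldType.

(* No positivity: the inner product attached to W may be indefinite. *)
Definition is_weight n (W : 'M[C]_n) : Prop :=
  W \in unitmx /\ W \is hermsymmx.

(* X maps C^q, with weight Wq, to C^p, with weight Wp. *)
Definition wadj p q (Wp : 'M[C]_p) (Wq : 'M[C]_q) (X : 'M[C]_(p, q)) :
  'M[C]_(q, p) := invmx Wq *m X ^t* *m Wp.

(* Y is the Moore-Penrose inverse of X. Such a Y need not exist for indefinite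
   weights; it is unique if it does (is_mpinv_inj). *)
Definition is_mpinv p q (Wp : 'M[C]_p) (Wq : 'M[C]_q)
    (X : 'M[C]_(p, q)) (Y : 'M[C]_(q, p)) : Prop :=
  [/\ X *m Y *m X = X,
      Y *m X *m Y = Y,
      wadj Wp Wp (X *m Y) = X *m Y
    & wadj Wq Wq (Y *m X) = Y *m X].

Lemma wadjM p q r (Wp : 'M[C]_p) (Wq : 'M[C]_q) (Wr : 'M[C]_r)
    (X : 'M[C]_(p, q)) (Y : 'M[C]_(q, r)) : Wq \in unitmx ->
  wadj Wp Wr (X *m Y) = wadj Wq Wr Y *m wadj Wp Wq X.
Proof.
by move=> uW; rewrite /wadj trmx_mul map_mxM !mulmxA mulmxK.
Qed.

Lemma is_mpinv_inj p q (Wp : 'M[C]_p) (Wq : 'M[C]_q)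
    (X : 'M[C]_(p, q)) (Y Z : 'M[C]_(q, p)) :
  Wp \in unitmx -> Wq \in unitmx ->
  is_mpinv Wp Wq X Y -> is_mpinv Wp Wq X Z -> Y = Z.
Proof.
move=> uWp uWq [XYX YXY XYs YXs] [XZX ZXZ XZs ZXs].
have eX : X *m Y = X *m Z.
  rewrite -XYs -{1}XZX -(mulmxA (X *m Z)) (wadjM _ _ _ _ uWp) XYs XZs.
  by rewrite mulmxA XYX.
have eY : Y *m X = Z *m X.
  rewrite -YXs -{1}XZX -(mulmxA X) mulmxA (wadjM _ _ _ _ uWq) YXs ZXs.
  by rewrite -mulmxA (mulmxA X) XYX.
by rewrite -YXY -mulmxA eX mulmxA eY.
Qed.

End WeightedMoorePenrose.

(* Main.v *)
Require Import Defs.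
From mathcomp Require Import all_boot all_order all_algebra.

(** Write # for the weighted adjoint, D = A B, X = Bp Ap, E = A A# D and
F = D B# B. The idea is to show that both sides of the equivalence say

    D X D = D,   D X E = E,   F X D = F.                                (1)

The rank condition. The block matrix has the rank of its corner D exactly when
E = D Z, F = Y D and D D# D = Y D Z for some Y and Z (rank_block_mx_eq_ul).
Since Ap A A# = A# and B# B Bp = B#, the last corner is D D# D = F X E. The
Gram matrices A A# and B# B are invertible on the relevant ranges
(mpinv_gram_cancel), so E and F have the same rank as D, and the factorizations
can be reversed: D = E W and D = V F. Cancelling with V and W in
F X E = Y D Z gives (1); conversely (1) gives the factorizations with Y = F X
and Z = X E (rank_block_reverse_order).

The reverse order law. Put H = D X and K = A A#. One always has
H K = A (B Bp) A#, which is selfadjoint, so that H K = K H#. If D X E = E, then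
moreover H K H = K H, whence K H# H = K H; as K cancels on these ranges,
H = H# H is selfadjoint (wadj_fixed_of_gram). The adjoint of
X D is treated in the same way with B# B in place of A A#, and X D X = X comes
from the adjoint of the idempotence of (Ap A) (B Bp). Conversely, if H is
selfadjoint, it commutes with K, and (1) follows from D X D = D
(mpinv_reverse_order). *)

Set Implicit Arguments.
Unset Strict Implicit.
Unset Printing Implicit Defensive.

Import GRing.Theory Num.Theory.
Local Open Scope ring_scope.
Local Open Scope sesquilinear_scope.

(** * Ranks and factorizations *)

Section RankFactorization.
Variable F : fieldType.

(** A left multiple of X that does not lose rank has the same row space as X,
so the multiplication can be undone. *)
Lemma left_factor_rank m1 m2 n (X : 'M[F]_(m1, n)) (Y : 'M[F]_(m2, n))
    (T : 'M[F]_(m2, m1)) :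
  Y = T *m X -> (\rank X <= \rank Y)%N -> exists S, X = S *m Y.
Proof.
move=> YTX leXY.
have sYX : (Y <= X)%MS by rewrite YTX submxMl.
apply/submxP; rewrite -(mxrank_leqif_sup sYX).
by rewrite eqn_leq leXY mxrankS.
Qed.

Lemma right_factor_rank m n1 n2 (X : 'M[F]_(m, n1)) (Y : 'M[F]_(m, n2))
    (T : 'M[F]_(n1, n2)) :
  Y = X *m T -> (\rank X <= \rank Y)%N -> exists S, X = Y *m S.
Proof.
move=> YXT leXY.
have [||S eS] := @left_factor_rank _ _ _ X^T Y^T T^T.
- by rewrite YXT trmx_mul.
- by rewrite !mxrank_tr.
by exists S^T; apply: trmx_inj; rewrite eS trmx_mul trmxK.
Qed.

(** The rank of the whole is that of its corner D only if adjoining E loses no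
column space and adjoining the lower rows loses no row space; then the lower
rows are Y times the upper rows, which forces the shape of the last corner. *)
Lemma rank_block_mx_eq_ul m1 m2 n1 n2 (D : 'M[F]_(m1, n1))
    (E : 'M[F]_(m1, n2)) (G : 'M[F]_(m2, n1)) (H : 'M[F]_(m2, n2)) :
  \rank (block_mx D E G H) = \rank D <->
  exists Y Z, [/\ E = D *m Z, G = Y *m D & H = Y *m D *m Z].
Proof.
have DE : D = row_mx D E *m col_mx 1%:M 0.
  by rewrite mul_row_col mulmx1 mulmx0 addr0.
have DEb : row_mx D E = row_mx 1%:M 0 *m block_mx D E G H.
  by rewrite mul_row_block !mul1mx !mul0mx !addr0.
have leDE : (\rank D <= \rank (row_mx D E))%N by rewrite {1}DE mxrankM_maxl.
have leDEb : (\rank (row_mx D E) <= \rank (block_mx D E G H))%N.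
  by rewrite DEb mxrankM_maxr.
split=> [rkD | [Y [Z [-> -> ->]]]].
  have [|S eS] := left_factor_rank DEb; first by rewrite rkD.
  have [|T eT] := right_factor_rank DE; first by rewrite -rkD.
  have [_ eE] : D = D *m lsubmx T /\ E = D *m rsubmx T.
    by apply: eq_row_mx; rewrite -mul_mx_row hsubmxK.
  have eGH : row_mx G H = dsubmx S *m row_mx D E.
    have := congr1 dsubmx eS.
    by rewrite -mul_dsub_mx /block_mx col_mxKd.
  move: eGH; rewrite mul_mx_row => /eq_row_mx[eG eH].
  by exists (dsubmx S), (rsubmx T); rewrite -mulmxA -eE.
have -> : block_mx D (D *m Z) (Y *m D) (Y *m D *m Z) =
          col_mx 1%:M Y *m D *m row_mx 1%:M Z.
  by rewrite mul_col_mx mul1mx mul_col_row !mulmx1.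
apply/eqP; rewrite eqn_leq (leq_trans (mxrankM_maxl _ _)) ?mxrankM_maxr //=.
have {1}-> : D = row_mx 1%:M 0 *m (col_mx 1%:M Y *m D *m row_mx 1%:M Z) *m
             col_mx 1%:M 0.
  rewrite -!mulmxA mul_row_col mulmx1 mulmx0 addr0 mulmx1.
  by rewrite mulmxA mul_row_col mul1mx mul0mx addr0 mul1mx.
by rewrite (leq_trans (mxrankM_maxl _ _)) ?mxrankM_maxr.
Qed.

End RankFactorization.

(** * Adjoints and Moore-Penrose inverses for indefinite weights *)

Section WeightedAdjoint.
Variable C : numClosedFieldType.

Lemma wadjK p q (Wp : 'M[C]_p) (Wq : 'M[C]_q) (X : 'M[C]_(p, q)) :
  is_weight Wp -> is_weight Wq -> wadj Wq Wp (wadj Wp Wq X) = X.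
Proof.
have herm k (W : 'M[C]_k) : W \is hermsymmx -> W ^t* = W.
  by move=> /is_hermitianmxP; rewrite expr0 scale1r.
move=> [uWp /herm hWp] [uWq /herm hWq].
rewrite /wadj !trmx_mul !map_mxM trmx_inv map_invmx hWq hWp.
have -> : (X ^t*) ^t* = X.
  by apply/matrixP=> i j; rewrite !mxE conjCK.
by rewrite !mulmxA mulVmx // mul1mx mulmxKV.
Qed.

Lemma is_mpinv_wadj p q (Wp : 'M[C]_p) (Wq : 'M[C]_q)
    (X : 'M[C]_(p, q)) (Y : 'M[C]_(q, p)) :
  is_weight Wp -> is_weight Wq -> is_mpinv Wp Wq X Y ->
  is_mpinv Wq Wp (wadj Wp Wq X) (wadj Wq Wp Y).
Proof.
move=> [uWp _] [uWq _] [XYX YXY XYs YXs].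
rewrite /is_mpinv -!(wadjM _ _ _ _ uWp) -!(wadjM _ _ _ _ uWq).
rewrite -!(wadjM _ _ _ _ uWp).
by rewrite !mulmxA XYX YXY XYs YXs XYs YXs.
Qed.

(** The Gram matrix X X# has the inverse Y# Y on the range of the projection
X Y. For an indefinite weight X X# may lose rank in general; it is the
existence of Y that prevents it. The witness is left abstract because only the
cancellation matters. *)
Lemma mpinv_gram_cancel p q (Wp : 'M[C]_p) (Wq : 'M[C]_q)
    (X : 'M[C]_(p, q)) (Y : 'M[C]_(q, p)) :
  is_weight Wp -> is_weight Wq -> is_mpinv Wp Wq X Y ->
  exists U, U *m (X *m wadj Wp Wq X) = X *m Y /\
            X *m wadj Wp Wq X *m U = X *m Y.
Proof.
move=> wWp wWq [XYX _ XYs YXs]; exists (wadj Wq Wp Y *m Y).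
have [uWp _] := wWp; have [uWq _] := wWq.
(* Y# Y X X# = Y# (Y X)# X# = (X Y X Y)# = (X Y)#. *)
have UK : wadj Wq Wp Y *m Y *m (X *m wadj Wp Wq X) = X *m Y.
  rewrite mulmxA -(mulmxA _ Y) -YXs -(wadjM _ _ _ _ uWq).
  by rewrite -(wadjM _ _ _ _ uWq) !mulmxA XYX XYs.
split=> //; rewrite -XYs -UK.
rewrite (wadjM _ _ _ _ uWp) (wadjM _ _ _ _ uWq).
by rewrite (wadjM _ _ _ _ uWq) (wadjK _ wWp wWq) (wadjK _ wWq wWp).
Qed.

(** The hypotheses give K H# H = H K H = K H; cancelling K on the left yields
H# H = H, and a matrix of the form H# H is selfadjoint. *)
Lemma wadj_fixed_of_gram p (W K U H : 'M[C]_p) :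
  is_weight W ->
  H *m K = K *m wadj W W H -> H *m K *m H = K *m H ->
  U *m K *m H = H -> U *m K *m wadj W W H = wadj W W H ->
  wadj W W H = H.
Proof.
move=> wW HK HKH UKH UKHs.
have HsH : wadj W W H *m H = H.
  (* The adjoint is generalized so that associativity does not rewrite inside
     the product that defines it. *)
  move: (wadj W W H) HK UKHs => Hs HK UKHs.
  by rewrite -{1}UKHs -[RHS]UKH -!mulmxA (mulmxA K) -HK HKH.
by rewrite -{1}HsH (wadjM _ _ _ _ wW.1) (wadjK _ wW wW) HsH.
Qed.

End WeightedAdjoint.

(** * The reverse order law *)

Section ReverseOrder.
Variables (C : numClosedFieldType) (m n l : nat).
Variables (M : 'M[C]_m) (N : 'M[C]_n) (L : 'M[C]_l).
Variables (A : 'M[C]_(m, n)) (B : 'M[C]_(n, l)).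
Variables (Ap : 'M[C]_(n, m)) (Bp : 'M[C]_(l, n)).
Hypotheses (wM : is_weight M) (wN : is_weight N) (wL : is_weight L).
Hypotheses (mpA : is_mpinv M N A Ap) (mpB : is_mpinv N L B Bp).

(* The adjoints of A and B are variables tied by equations, so that
   associativity does not rewrite inside the products that define them. *)
Variables (As : 'M[C]_(n, m)) (Bs : 'M[C]_(l, n)).
Hypotheses (AsE : wadj M N A = As) (BsE : wadj N L B = Bs).

Let D := A *m B.
Let X := Bp *m Ap.
Let E := A *m As *m D.
Let F := D *m Bs *m B.

Let AsK : wadj N M As = A.
Proof. by rewrite -AsE wadjK. Qed.

Let BsK : wadj L N Bs = B.
Proof. by rewrite -BsE wadjK. Qed.

Let ApAAs : Ap *m A *m As = As.
Proof.
have [AApA _ _ ApAs] := mpA.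
by rewrite -ApAs -AsE -(wadjM _ _ _ _ wN.1) mulmxA AApA.
Qed.

Let BsBBp : Bs *m (B *m Bp) = Bs.
Proof.
have [BBpB _ BBps _] := mpB.
by rewrite -BBps -BsE -(wadjM _ _ _ _ wN.1) BBpB.
Qed.

Lemma gram_cancelA : exists U, U *m (A *m As) = A *m Ap.
Proof.
by have [U [UK _]] := mpinv_gram_cancel wM wN mpA; exists U; rewrite -AsE.
Qed.

(** mpinv_gram_cancel for the pair formed by the adjoints of B and Bp, whose
Gram matrix is B# B. *)
Lemma gram_cancelB :
  exists U, U *m (Bs *m B) = Bp *m B /\ Bs *m B *m U = Bp *m B.
Proof.
have [_ _ _ BpBs] := mpB.
have := mpinv_gram_cancel wL wN (is_mpinv_wadj wN wL mpB).
by rewrite BsE BsK -BsE -(wadjM _ _ _ _ wN.1) BpBs BsE.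
Qed.

(** The last corner of the block matrix is F X E, so the rank condition
compares F X E with Y D Z; E and F having the rank of D, the outer factors can
be cancelled. *)
Lemma rank_block_reverse_order :
  \rank (block_mx D E F (D *m wadj M L D *m D)) = \rank D <->
  [/\ D *m X *m D = D, D *m X *m E = E & F *m X *m D = F].
Proof.
have [AApA _ _ _] := mpA; have [BBpB _ _ _] := mpB.
have GFXE : D *m wadj M L D *m D = F *m X *m E.
  rewrite (wadjM _ _ _ _ wN.1) AsE BsE -{1}BsBBp -{1}ApAAs.
  by rewrite /E /F /X !mulmxA.
have [U DUE] : exists U, D = U *m E.
  have [U UK] := gram_cancelA; exists U.
  by rewrite /E mulmxA UK /D mulmxA AApA.
have [U' DFU] : exists U', D = F *m U'.
  have [U' [_ KU']] := gram_cancelB; exists U'.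
  by rewrite /F -(mulmxA D) -(mulmxA D) KU' /D -!mulmxA (mulmxA B) BBpB.
split=> [/rank_block_mx_eq_ul[Y [Z [eE eF]]] | [DXD DXE FXD]].
  rewrite GFXE => eG.
  have [|W eW] := right_factor_rank eE; first by rewrite {1}DUE mxrankM_maxr.
  have [|V eV] := left_factor_rank eF; first by rewrite {1}DFU mxrankM_maxl.
  have DXE : D *m X *m E = E.
    rewrite {1}eV -!(mulmxA V) eG -eF.
    by rewrite mulmxA -eV -eE.
  have FXD : F *m X *m D = F.
    by rewrite {1}eW mulmxA eG -(mulmxA Y D) -(mulmxA Y) -eE -eW -eF.
  by split=> //; rewrite {2}eW mulmxA DXE -eW.
apply/rank_block_mx_eq_ul; exists (F *m X), (X *m E).
by rewrite GFXE FXD !(mulmxA _ X) DXE.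
Qed.

(** The conditions on E and F amount to D X and X D being selfadjoint:
D X A A# and B# B X D are selfadjoint in any case, so selfadjointness of D X
and X D means commutation with the invertible-on-range Gram matrices. *)
Lemma mpinv_reverse_order :
  is_mpinv M L D X <->
  [/\ D *m X *m D = D, D *m X *m E = E & F *m X *m D = F].
Proof.
have [uM _] := wM; have [uN _] := wN; have [uL _] := wL.
have [AApA ApAAp AAps ApAs] := mpA; have [BBpB BpBBp BBps BpBs] := mpB.
set K := A *m As; set K' := Bs *m B.
have Ks : wadj M M K = K by rewrite (wadjM _ _ _ _ uN) AsE AsK.
have K's : wadj L L K' = K' by rewrite (wadjM _ _ _ _ uN) BsE BsK.
have HK : D *m X *m K = K *m wadj M M (D *m X).
  rewrite -{2}Ks -(wadjM _ _ _ _ uM).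
  have -> : D *m X *m K = A *m (B *m Bp) *m As.
    by rewrite /K /D /X -[in RHS]ApAAs !mulmxA.
  by rewrite !(wadjM _ _ _ _ uN) AsE AsK BBps !mulmxA.
have KH : K' *m (X *m D) = wadj L L (X *m D) *m K'.
  rewrite -{2}K's -(wadjM _ _ _ _ uL).
  have -> : K' *m (X *m D) = Bs *m (Ap *m A) *m B.
    by rewrite /K' /D /X -[in RHS]BsBBp !mulmxA.
  by rewrite !(wadjM _ _ _ _ uN) BsE BsK ApAs !mulmxA.
have FE : F = D *m K' by rewrite /F /K' mulmxA.
split=> [[DXD _ DXs XDs] | [DXD DXE FXD]].
  rewrite DXs in HK; rewrite XDs in KH.
  split=> //; first by rewrite /E -/K mulmxA HK -mulmxA DXD.
  by rewrite FE -2!mulmxA KH (mulmxA D) (mulmxA D) DXD.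
split=> //.
(* D X D = D says that the product of the two projections Ap A and B Bp is
   idempotent; its adjoint is the product in the other order, and idempotence
   of the latter gives X D X = X. *)
- have PQPQ : Ap *m A *m (B *m Bp) *m (Ap *m A) *m (B *m Bp)
              = Ap *m A *m (B *m Bp).
    have := congr1 (fun T => Ap *m T *m Bp) DXD.
    by rewrite /D /X !mulmxA.
  have QPQP : B *m Bp *m (Ap *m A *m (B *m Bp *m (Ap *m A)))
              = B *m Bp *m (Ap *m A).
    by have := congr1 (wadj N N) PQPQ; rewrite !(wadjM _ _ _ _ uN) ApAs BBps.
  have := congr1 (fun T => Bp *m T *m Ap) QPQP.
  rewrite !mulmxA BpBBp -!(mulmxA _ Ap A) -!(mulmxA _ (Ap *m A) Ap) ApAAp.
  by rewrite /D /X !mulmxA.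
- have [U UK] := gram_cancelA.
  apply: (@wadj_fixed_of_gram _ _ M K U) => //.
  + by move/(congr1 (mulmx^~ X)): DXE; rewrite /E -/K !mulmxA.
  + by rewrite UK /D !mulmxA AApA.
  rewrite UK -{1}AAps -(wadjM _ _ _ _ uM).
  by congr (wadj M M _); rewrite /X -!mulmxA (mulmxA Ap) ApAAp.
have [U [UK _]] := gram_cancelB.
(* For X D the Gram matrix stands on the other side, so the cancellation lemma
   is applied to the adjoint of X D. *)
have XDss : wadj L L (wadj L L (X *m D)) = X *m D by rewrite (wadjK _ wL wL).
rewrite -[RHS]XDss; apply/esym.
apply: (@wadj_fixed_of_gram _ _ L K' U) => //.
- by rewrite XDss KH.
- have XDKXD : X *m D *m K' *m (X *m D) = X *m D *m K'.
    by have := congr1 (mulmx X) FXD; rewrite FE !mulmxA.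
  have := congr1 (wadj L L) XDKXD.
  by rewrite !(wadjM _ _ _ _ uL) K's mulmxA.
- rewrite UK -{1}BpBs -(wadjM _ _ _ _ uL).
  by congr (wadj L L _); rewrite /D -!mulmxA (mulmxA B) BBpB.
by rewrite XDss UK /X !mulmxA BpBBp.
Qed.

End ReverseOrder.

Theorem theorem3p6 (R : realType) (m n l : nat)
    (M : 'M[R[i]]_m) (N : 'M[R[i]]_n) (L : 'M[R[i]]_l)
    (A : 'M[R[i]]_(m, n)) (B : 'M[R[i]]_(n, l)) (D : 'M[R[i]]_(m, l))
    (Ap : 'M[R[i]]_(n, m)) (Bp : 'M[R[i]]_(l, n))
    (weightM : is_weight M) (weightN : is_weight N) (weightL : is_weight L)
    (defD : D = A *m B)
    (mpA : is_mpinv M N A Ap) (mpB : is_mpinv N L B Bp) :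
  \rank (block_mx D                         (A *m wadj M N A *m D)
                  (D *m wadj N L B *m B)    (D *m wadj M L D *m D)) = \rank D
  <->
  exists Dp : 'M[R[i]]_(l, m), is_mpinv M L (A *m B) Dp /\ Dp = Bp *m Ap.
Proof.
have rk := rank_block_reverse_order weightM weightN weightL mpA mpB erefl erefl.
have mp := mpinv_reverse_order weightM weightN weightL mpA mpB erefl erefl.
rewrite defD; split=> [/rk/mp mpD | [Dp [mpD eDp]]].
  by exists (Bp *m Ap).
by apply/rk/mp; rewrite -eDp.
Qed.
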